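(* Let $G$ be a non abelian subgroup of $\mathcal{S}_{n}$. Then the following assertions are equivalent: (i) $G$ has a dense orbit (in $\mathbb{R}^n$); (ii) every orbit of $G$ is dense in $\mathbb{R}^n$; (iii) the orbit $G(0)$ is dense in $\mathbb{R}^{n}$; (iv) $H_{G}$ is dense in $\mathbb{R}^{n}$.
   Context: Let $n\ge1$. $\mathcal{S}_n$ is the group (under composition) of all maps $f:\mathbb{R}^n\to\mathbb{R}^n$ of the form $f(x)=\varepsilon x+c$ with $\varepsilon\in\{-1,1\}$, $c\in\mathbb{R}^n$; $\mathcal{T}_n$ is its subgroup of translations ($\varepsilon=1$). For $v\in\mathbb{R}^n$, $G(v)=\{f(v):f\in G\}$ is the orbit of $v$. $G_1=G\cap\mathcal{T}_n$ and $H_G=G_1(0)=\{f(0):f\in G_1\}$. *)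

(* Defs.v *)
From HB Require Import structures.
From mathcomp Require Import all_boot all_order all_algebra.
From mathcomp Require Import boolp classical_sets reals topology normedtype.

Set Implicit Arguments.
Unset Strict Implicit.
Unset Printing Implicit Defensive.

Import Order.TTheory GRing.Theory Num.Theory.
Import numFieldNormedType.Exports.

Local Open Scope classical_set_scope.
Local Open Scope ring_scope.

(* MathComp has no bundled group of self-maps of an infinite type, so groups of
   maps under composition are sets of functions with closure properties. *)
Definition composition_group (V : Type) (G : set (V -> V)) : Prop :=
  [/\ G idfun,
      forall f g, G f -> G g -> G (f \o g) &
      forall f, G f -> exists g, [/\ G g, cancel f g & cancel g f] ].

Definition subgroup_of (V : Type) (G K : set (V -> V)) : Prop :=
  G `<=` K /\ composition_group G.

Definition abelian_maps (V : Type) (G : set (V -> V)) : Prop :=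
  forall f g, G f -> G g -> f \o g = g \o f.

Definition orbit_at (V : Type) (G : set (V -> V)) (v : V) : set V :=
  [set f v | f in G].

Definition Sn (R : realType) (n : nat) : set ('rV[R]_n -> 'rV[R]_n) :=
  [set f | exists eps : R, exists c : 'rV[R]_n,
    (eps = -1 \/ eps = 1) /\ f = (fun x => eps *: x + c) ].

Definition Tn (R : realType) (n : nat) : set ('rV[R]_n -> 'rV[R]_n) :=
  [set f | exists c : 'rV[R]_n, f = (fun x => x + c) ].

Arguments Sn : clear implicits.
Arguments Tn : clear implicits.

Definition G1 (R : realType) (n : nat) (G : set ('rV[R]_n -> 'rV[R]_n)) :
  set ('rV[R]_n -> 'rV[R]_n) := G `&` Tn R n.

Definition HG (R : realType) (n : nat) (G : set ('rV[R]_n -> 'rV[R]_n)) :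
  set 'rV[R]_n := orbit_at (G1 G) 0.

Lemma Sn_composition_group (R : realType) (n : nat) :
  composition_group (Sn R n).
Proof.
split.
- by exists 1, 0; split; [right | apply/funext => x; rewrite scale1r addr0].
- move=> _ _ [e [c [he ->]]] [e' [c' [he' ->]]].
  exists (e * e'), (e *: c' + c); split.
    by case: he => ->; case: he' => ->; rewrite ?mulN1r ?mul1r ?opprK; auto.
  by apply/funext => x /=; rewrite scalerDr scalerA addrA.
- move=> _ [e [c [he ->]]].
  have ee : e * e = 1 by case: he => ->; rewrite ?mulrNN mulr1.
  exists (fun x => e *: x + - (e *: c)); split.
  + by exists e, (- (e *: c)).
  + by move=> x; rewrite scalerDr scalerA ee scale1r addrK.
  + by move=> x; rewrite scalerDr scalerN !scalerA ee !scale1r subrK.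
Qed.

Lemma Tn_subgroup (R : realType) (n : nat) : subgroup_of (Tn R n) (Sn R n).
Proof.
split=> [_ [c ->]|].
  by exists 1, c; split; [right | apply/funext => x; rewrite scale1r].
split.
- by exists 0; apply/funext => x; rewrite addr0.
- move=> _ _ [c ->] [c' ->]; exists (c' + c).
  by apply/funext => x /=; rewrite addrA.
- move=> _ [c ->]; exists (fun x => x + - c); split; first by exists (- c).
  + by move=> x; rewrite addrK.
  + by move=> x; rewrite subrK.
Qed.

(* Main.v *)
Require Import Defs.
From HB Require Import structures.
From mathcomp Require Import all_boot all_order all_algebra.
From mathcomp Require Import boolp classical_sets reals topology normedtype.

Import Order.TTheory GRing.Theory Num.Theory.
Import numFieldNormedType.Exports.

Local Open Scope classical_set_scope.
Local Open Scope ring_scope.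

(** Write [H] for the additive group [HG G] of translation vectors of [G].  An
element of [G] is either a translation by a vector of [H] or a reflection
[x |-> a - x], and two reflections differ by a translation.  Hence any orbit of
[G] is covered by at most two cosets of [H], one of which is [v + H].

If [H] is dense, so is each [v + H], and with it each orbit ([dense_translate],
[HG_translate_orbit]).  Conversely, if an orbit is dense then two translates of
the closure of [H] cover the space.  Given [z], two of the three points [0],
[z], [2z] lie in the same translate; their difference is [z] or [2z] up to
sign, so in either case [2z] is in the closure of [H].  As every vector is of
the form [2z], [H] is dense ([dense_two_cosets]).  This is the fact that a
2-divisible group has no subgroup of index two, applied to the closure of [H].
So density of one orbit, of all orbits, or of the orbit of [0] each amounts to
density of [H]. *)

Lemma denseE (T : topologicalType) (S : set T) :
  dense S <-> forall x, closure S x.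
Proof.
split=> [dS x | clS O [x Ox] oO].
  move=> B /nbhs_interior/nbhs_singleton Bx.
  have [y [By Sy]] := dS B° (ex_intro _ x Bx) (open_interior B).
  by exists y; split; [|exact: interior_subset].
by rewrite setIC; apply: (clS x); exact: open_nbhs_nbhs.
Qed.

Lemma dense_subset (T : topologicalType) (A B : set T) :
  A `<=` B -> dense A -> dense B.
Proof.
by move=> AB dA O O0 oO; have [x [Ox /AB Bx]] := dA O O0 oO; exists x.
Qed.

Section TopologicalGroup.
Context {V : topologicalZmodType}.
Implicit Types (A B H : set V) (p q v : V).

(** By continuity of subtraction.  With [A := H] it makes the closure of a
subgroup a subgroup; with [A] inside a coset of [H] it says that the closure of
[A] lies in a coset of the closure of [H]. *)
Lemma closure_sub A H :
    (forall a b, A a -> A b -> H (a - b)) ->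
  forall p q, closure A p -> closure A q -> closure H (p - q).
Proof.
move=> AAH p q clp clq W /(@sub_continuous V (p, q))[[P Q] /= [nP nQ] PQW].
have [a [Aa Pa]] := clp P nP; have [b [Ab Qb]] := clq Q nQ.
by exists (a - b); split; [exact: AAH | exact: (PQW (a, b))].
Qed.

Lemma dense_translate H v : dense H -> dense [set v + h | h in H].
Proof.
move=> /denseE clH; apply/denseE => x W.
rewrite -(subrKC v x) => /(@add_continuous V (v, x - v))[[P Q] /= [nP nQ] PQW].
have [h [Hh Qh]] := clH (x - v) Q nQ.
exists (v + h); split; first by exists h.
by apply: (PQW (v, h)); split=> //=; exact: nbhs_singleton.
Qed.

(** Only differences within [A] and within [B] are constrained, so that either
set may be empty: this treats at once the groups with and without
reflections. *)
Lemma dense_two_cosets A B H :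
    (forall y : V, exists z, y = z + z) ->
    (forall x y, H x -> H y -> H (x - y)) ->
    (forall x y, A x -> A y -> H (x - y)) ->
    (forall x y, B x -> B y -> H (x - y)) ->
  dense (A `|` B) -> dense H.
Proof.
move=> half HH AH BH /denseE clAB; apply/denseE => y.
have [z ->] := half y.
have coset p q : closure A p /\ closure A q \/ closure B p /\ closure B q ->
    closure H (p - q).
  by case=> -[]; [exact: (closure_sub _ _ AH) | exact: (closure_sub _ _ BH)].
have cl2 : closure H z -> closure H (z + z).
  have clB := closure_sub _ _ HH.
  move=> clz; have cl0 := clB z z clz clz; have clN := clB _ _ cl0 clz.
  by rewrite -{2}[z]opprK -[- z]sub0r -(subrr z); exact: clB.
have E1 : (z + z) - z = z by rewrite addrK.
have E2 : z - 0 = z by rewrite subr0.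
have E3 : (z + z) - 0 = z + z by rewrite subr0.
have := (clAB 0, clAB z, clAB (z + z)); rewrite closureU => -[[]].
(* By pigeonhole, two of 0, z and z + z lie in the same one of the two closures;
   each case picks such a pair. *)
case=> c0 [] c1 [] c2.
- by apply: cl2; rewrite -E2; apply: coset; left.
- by apply: cl2; rewrite -E2; apply: coset; left.
- by rewrite -E3; apply: coset; left.
- by apply: cl2; rewrite -E1; apply: coset; right.
- by apply: cl2; rewrite -E1; apply: coset; left.
- by rewrite -E3; apply: coset; right.
- by apply: cl2; rewrite -E2; apply: coset; right.
- by apply: cl2; rewrite -E2; apply: coset; right.
Qed.

End TopologicalGroup.

Section SignedTranslations.
Context {R : realType} {n : nat} {G : set ('rV[R]_n -> 'rV[R]_n)}.
Context (GS : subgroup_of G (Sn R n)).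

Lemma HGP (h : 'rV[R]_n) : HG G h <-> G (fun x => x + h).
Proof.
split=> [[f [Gf [c fE]] <-]|Gh]; first by rewrite fE in Gf *; rewrite add0r.
by exists (fun x => x + h); rewrite ?add0r //; split=> //; exists h.
Qed.

Lemma HG_sub (x y : 'rV[R]_n) : HG G x -> HG G y -> HG G (x - y).
Proof.
case: GS => _ [_ GM GV] /HGP Gx /HGP /GV[g [Gg _ gK]]; apply/HGP.
have -> : (fun z => z + (x - y)) = (fun z => z + x) \o g.
  by apply/funext => z /=; rewrite -{1}(gK z) [x - y]addrC addrA addrK.
exact: GM.
Qed.

(** The composite of two reflections is a translation. *)
Lemma HG_reflections (a b : 'rV[R]_n) :
  G (fun x => - x + a) -> G (fun x => - x + b) -> HG G (a - b).
Proof.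
case: GS => _ [_ GM _] Ga Gb; apply/HGP.
have -> : (fun z => z + (a - b)) = (fun x => - x + a) \o (fun x => - x + b).
  by apply/funext => z /=; rewrite opprD opprK -addrA [- b + a]addrC.
exact: GM.
Qed.

Lemma HG_translate_orbit (v : 'rV[R]_n) :
  [set v + h | h in HG G] `<=` orbit_at G v.
Proof. by move=> _ [h /HGP Gh <-]; exists (fun x => x + h). Qed.

Lemma orbit_two_cosets (v : 'rV[R]_n) :
  orbit_at G v `<=`
    [set v + h | h in HG G] `|` [set - v + a | a in [set a | G (fun x => - x + a)]].
Proof.
move=> _ [f Gf <-]; have [eps [c [[] -> fE]]] := GS.1 f Gf; rewrite fE in Gf *.
- right; exists c; last by rewrite scaleN1r.
  by rewrite /= (_ : (fun _ => _) = (fun x => -1 *: x + c)) //;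
    apply/funext => x; rewrite scaleN1r.
- left; exists c; last by rewrite scale1r.
  by apply/HGP; rewrite (_ : (fun _ => _) = (fun x => 1 *: x + c)) //;
    apply/funext => x; rewrite scale1r.
Qed.

Lemma dense_orbit_HG (v : 'rV[R]_n) : dense (orbit_at G v) -> dense (HG G).
Proof.
move=> /(dense_subset _ _ _ (orbit_two_cosets v)).
apply: dense_two_cosets.
- by move=> y; exists (2^-1 *: y); rewrite -scalerDl -[2^-1]mul1r -splitr scale1r.
- exact: HG_sub.
- by move=> _ _ [h Hh <-] [k Hk <-]; rewrite [v + h]addrC addrKA; exact: HG_sub.
- by move=> _ _ [a Ga <-] [b Gb <-]; rewrite [- v + a]addrC addrKA; exact: HG_reflections.
Qed.

Lemma dense_HG_orbit (v : 'rV[R]_n) : dense (HG G) -> dense (orbit_at G v).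
Proof.
move=> dH; apply: dense_subset (HG_translate_orbit v) _.
exact: dense_translate.
Qed.

End SignedTranslations.

Theorem corollary1p6 (R : realType) (n : nat) (n_ge1 : (1 <= n)%N)
    (G : set ('rV[R]_n -> 'rV[R]_n))
    (G_subgroup : subgroup_of G (Sn R n))
    (G_nonabelian : ~ abelian_maps G) :
  [<-> exists v : 'rV[R]_n, dense (orbit_at G v);
       forall v : 'rV[R]_n, dense (orbit_at G v);
       dense (orbit_at G 0);
       dense (HG G)].
Proof.
tfae.
- move=> [w dw] v; apply: dense_HG_orbit.
  exact: (dense_orbit_HG G_subgroup w).
- exact.
- exact: dense_orbit_HG.
- by move=> dH; exists 0; exact: dense_HG_orbit.
Qed.
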